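(* For every natural number $n$ with $n \equiv 3 \pmod 4$, the integer $1+3\cdot 2^{n}$ is not a prime number.
   Context: $\mathbb{N}$ denotes the set of natural numbers, including $0$. *)

(* Defs.v *)
From mathcomp Require Import all_boot.

(* Main.v *)
(* Since 2 ^ 4 = 1 and 3 * 2 ^ 3 = -1 modulo 5, the number 1 + 3 * 2 ^ n is
   a multiple of 5, and it exceeds 5 because n >= 3. *)
Require Import Defs.
From mathcomp Require Import all_boot.

(** Writing [n = 4k + 3] turns the number into [1 + 24 * 16 ^ k]. As 16 is 1 and 24 is -1 modulo 5,
    it is a multiple of 5; being at least 25, it is not 5 itself. *)

Theorem proposition3p1 (n : nat) : n = 3 %[mod 4] -> ~~ prime (1 + 3 * 2 ^ n).
Proof.
move=> n3; rewrite (divn_eq n 4) n3 (modn_small (isT : 3 < 4)).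
set k := n %/ 4.
have pow16 : 2 ^ (k * 4 + 3) = 16 ^ k * 8 by rewrite expnD (mulnC k) expnM.
have dvd5 : 5 %| 1 + 3 * 2 ^ (k * 4 + 3).
  have pow1 : 16 ^ k = 1 %[mod 5] by rewrite -modnXm exp1n.
  (* Once [16 ^ k] is replaced by 1 modulo 5, what remains is [1 + 24 = 25], settled by
     computation. *)
  by rewrite pow16 mulnCA /dvdn -modnDmr -modnMml pow1.
apply/negP => pr.
(* A prime divisible by the prime 5 must equal 5. *)
move: dvd5; rewrite (dvdn_prime2 (isT : prime 5) pr) pow16 => /eqP eq5.
have : 0 < 16 ^ k by rewrite expn_gt0.
(* A positive [16 ^ k] makes the right side of [5 = 1 + 16 ^ k * 24] at least 25. *)
by rewrite mulnCA in eq5; case: (16 ^ k) eq5.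
Qed.
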